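(* Let $n$ and $r$ be positive integers and let $\zeta_n$ be a primitive $n$-th root of unity. For any nonnegative integers $k,l,h_1,\ldots,h_r$, we have $$G^t_n(k,l,h_1,\ldots,h_r;\zeta_n)\in\mathbb{Q}[t].$$
   Context: $\mathbb{N}$ is the set of positive integers and $t$ is a formal parameter. For a multi-index $\mathbf{k}=(k_1,\ldots,k_l)\in\mathbb{N}^l$ define the weight $\mathrm{wt}(\mathbf{k})=k_1+\cdots+k_l$, the depth $\mathrm{dep}(\mathbf{k})=l$, and for $i\in\mathbb{N}$ the $i$-height $\#\{j\mid k_j\geq i+1\}$. Let $q$ be a complex number with $q^m\ne1$ for every positive integer $m<n$ (e.g. $q=\zeta_n$). For $\mathbf{k}\in\mathbb{N}^l$ with $l\ge 1$, $$\overline{z}_n(\mathbf{k};q)=\sum_{n>m_1>\cdots>m_l>0}\frac{q^{(k_1-1)m_1+\cdots+(k_l-1)m_l}}{(1-q^{m_1})^{k_1}\cdots(1-q^{m_l})^{k_l}},$$ and its interpolated version is $$\overline{z}_n^t(\mathbf{k};q)=\sum_{\mathbf{p}}\overline{z}_n(\mathbf{p};q)\,t^{l-\mathrm{dep}(\mathbf{p})},$$ where the sum runs over all $3^{l-1}$ ways of forming $\mathbf{p}=(k_1\Box\cdots\Box k_l)$ by filling each $\Box$ with '','' (comma), ''$+$'' or ''$-1+$''. For nonnegative integers $k,l,h_1,\ldots,h_r$ let $I(k,l,h_1,\ldots,h_r)$ be the set of multi-indices of weight $k$, depth $l$ and $i$-height $h_i$ for $i=1,\ldots,r$, and $$G_n^t(k,l,h_1,\ldots,h_r;q)=\sum_{\mathbf{k}\in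 I(k,l,h_1,\ldots,h_r)}\overline{z}_n^t(\mathbf{k};q),$$ which is $0$ when the index set is empty, except that $G_n^t(0,0,\ldots,0;q)=1$. *)

(* Defs.v *)
From mathcomp Require Import all_boot all_order all_algebra.

Set Implicit Arguments.
Unset Strict Implicit.
Unset Printing Implicit Defensive.

Import GRing.Theory.

Local Open Scope ring_scope.

(* A multi-index is a sequence of positive naturals; positivity is imposed in *)
(* [index_set] below, so the predecessors [_.-1] are genuine subtractions.    *)

Definition weight (ks : seq nat) : nat := sumn ks.

Definition depth (ks : seq nat) : nat := size ks.

Definition height (i : nat) (ks : seq nat) : nat := count (fun k => i < k)%N ks.

Definition zbar (F : fieldType) (n : nat) (q : F) (ks : seq nat) : F :=
  \sum_(m : {ffun 'I_(size ks) -> 'I_n} |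
         [forall i : 'I_(size ks), (0 < m i)%N] &&
         [forall i : 'I_(size ks),
            forall j : 'I_(size ks), (i < j)%N ==> (m j < m i)%N])
    \prod_(j < size ks)
       (q ^+ ((nth 0%N ks j).-1 * m j)%N / (1 - q ^+ m j) ^+ (nth 0%N ks j)).

(* All results, with multiplicity, of filling the boxes of k [] k_1 [] ...    *)
(* with a comma, "+" or "-1+"; the three sublists are the choices for the     *)
(* first box.                                                                 *)
Fixpoint fillings_from (k : nat) (ks : seq nat) : seq (seq nat) :=
  if ks is k1 :: ks1 then
    [seq k :: p | p <- fillings_from k1 ks1]
      ++ fillings_from (k + k1)%N ks1
      ++ fillings_from (k.-1 + k1)%N ks1
  else [:: [:: k]].

Definition fillings (ks : seq nat) : seq (seq nat) :=
  if ks is k :: ks1 then fillings_from k ks1 else [:: [::]].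

(* The interpolation parameter t is the polynomial variable 'X. *)
Definition zbart (F : fieldType) (n : nat) (q : F) (ks : seq nat) : {poly F} :=
  \sum_(p <- fillings ks) (zbar n q p)%:P * 'X^(depth ks - depth p).

(* Entries of a multi-index of weight k are at most k, so ranging over        *)
(* 'I_k.+1 loses nothing. The index j : 'I_r stands for i = j + 1.            *)
Definition index_set (k l r : nat) (h : 'I_r -> nat) : {set l.-tuple 'I_k.+1} :=
  [set ks : l.-tuple 'I_k.+1 |
    let s := map val ks in
    [&& all (fun x => 0 < x)%N s, weight s == k, depth s == l
      & [forall j : 'I_r, height j.+1 s == h j]]].

Definition Gsum (F : fieldType) (n : nat) (q : F)
    (k l r : nat) (h : 'I_r -> nat) : {poly F} :=
  if [&& k == 0%N, l == 0%N & [forall j, h j == 0%N]] then 1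
  else \sum_(ks in index_set k l h) zbart n q (map val ks).

(* Main.v *)
Require Import Defs.
From mathcomp Require Import all_boot all_order all_algebra all_fingroup.
From mathcomp Require Import mpoly ring zify.
From mathcomp Require Import reals complex.

Set Implicit Arguments.
Unset Strict Implicit.
Unset Printing Implicit Defensive.

Import Order.TTheory GRing.Theory Num.Theory.

Local Open Scope ring_scope.
Local Open Scope complex_scope.

(* Write b_m = 1 / (1 - zeta^m). The summand of index k at m is
   f_k(m) = b_m (b_m - 1)^(k-1), and f_k f_k' = f_(k+k') + f_(k+k'-1); hence the
   interpolated sum runs over weakly decreasing m_1 >= ... >= m_l, with a factor
   t for every equality. Recording weight and heights of an index by a monomial,
   and its depth by a power of a further variable, the sums G of the theorem become
   the coefficients of a product over m of one and the same polynomial expression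
   in b_m. This product is symmetric in b_1, ..., b_(n-1), and the elementary
   symmetric functions of the b_m are rational because they are the roots of
   X^n - (X - 1)^n. *)

(** * Interpolated sums as a recursion on the letters *)

Section InterpolatedSums.
Variables (A : comNzRingType) (t : A) (X : Type) (f : nat -> X -> A).

Fixpoint strict_sum (xs : seq X) (ks : seq nat) : A :=
  match xs, ks with
  | _, [::] => 1
  | [::], _ => 0
  | x :: xs', k :: ks' => strict_sum xs' ks + f k x * strict_sum xs' ks'
  end.

(* The preceding index has been placed at the top letter [x], so each further
   index either joins it, at the cost of a factor [t], or starts a sum over the
   remaining letters, given by [U]. *)
Fixpoint tied_sum (U : seq nat -> A) (x : X) (ks : seq nat) : A :=
  if ks is k :: ks' then U ks + t * f k x * tied_sum U x ks' else 1.

Fixpoint interp_sum (xs : seq X) (ks : seq nat) : A :=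
  match xs, ks with
  | _, [::] => 1
  | [::], _ => 0
  | x :: xs', k :: ks' => interp_sum xs' ks + f k x * tied_sum (interp_sum xs') x ks'
  end.

Lemma interp_sum0 xs : interp_sum xs [::] = 1. Proof. by case: xs. Qed.
Lemma strict_sum0 xs : strict_sum xs [::] = 1. Proof. by case: xs. Qed.

(** The bound on the size of [p'] makes the exponents of [t], written with truncated subtraction,
    genuine differences. *)
Lemma fillings_fromP k ks p : p \in fillings_from k ks ->
  exists k' p', p = k' :: p' /\ (size p' <= size ks)%N.
Proof.
elim: ks k p => [|k1 ks IH] k p /=.
  by rewrite inE => /eqP ->; exists k, [::].
rewrite !mem_cat => /orP[/mapP[p' /IH [k' [p'' [-> h]]] ->]|/orP[]/IH[k' [p'' [-> h]]]].
- by exists k, (k' :: p'').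
- by exists k', p''; split=> //; apply: leqW.
- by exists k', p''; split=> //; apply: leqW.
Qed.

Hypothesis f_merge : forall k k1 x, (0 < k)%N -> (0 < k1)%N ->
  f (k + k1) x + f (k.-1 + k1) x = f k x * f k1 x.

(* By [f_merge], filling the first box with "+" or "-1+" multiplies the summands at
   [x], so the contribution of the first entry factors out as [f k x]. *)
Lemma sum_fillings_head xs x k ks :
  (forall k1 ks1, (0 < k1)%N -> all (leq 1) ks1 ->
    \sum_(p <- fillings_from k1 ks1) strict_sum xs p * t ^+ ((size ks1).+1 - size p)
    = interp_sum xs (k1 :: ks1)) ->
  (0 < k)%N -> all (leq 1) ks ->
  \sum_(p <- fillings_from k ks)
     f (head 0%N p) x * strict_sum xs (behead p) * t ^+ ((size ks).+1 - size p)
  = f k x * tied_sum (interp_sum xs) x ks.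
Proof.
move=> Hxs; elim: ks k => [|k1 ks IH] k k_gt0 /=.
  by rewrite big_seq1 /= strict_sum0 expr0 mulr1.
case/andP=> k1_gt0 ks_gt0; rewrite !big_cat /= big_map /=.
(* Merging across a box loses one entry, hence the extra factor [t]. *)
have step a : (0 < a)%N -> 
  \sum_(p <- fillings_from a ks)
     f (head 0%N p) x * strict_sum xs (behead p) * t ^+ ((size ks).+2 - size p)
   = t * (f a x * tied_sum (interp_sum xs) x ks).
  move=> a_gt0; rewrite -IH // mulr_sumr !big_seq; apply: eq_bigr => p.
  case/fillings_fromP=> k' [p' [-> hp]] /=.
  by rewrite !subSS subSn // exprS mulrCA.
rewrite !step ?addn_gt0 ?k_gt0 ?k1_gt0 ?orbT // mulrDr -Hxs // mulr_sumr.
congr (_ + _); first by apply: eq_bigr => p _; rewrite subSS mulrA.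
by rewrite -mulrDr -mulrDl f_merge //; ring.
Qed.

(** Induction on the letters: the first entry of a filling either avoids the top letter, which is
    the induction hypothesis, or sits at it, which is [sum_fillings_head]. *)
Lemma sum_fillings_from xs k ks : (0 < k)%N -> all (leq 1) ks ->
  \sum_(p <- fillings_from k ks) strict_sum xs p * t ^+ ((size ks).+1 - size p)
  = interp_sum xs (k :: ks).
Proof.
elim: xs k ks => [|x xs IH] k ks k_gt0 ks_gt0.
  rewrite big_seq big1 // => p /fillings_fromP[k' [p' [-> _]]] /=.
  by rewrite mul0r.
rewrite [RHS]/= -(sum_fillings_head x IH) // -IH // -big_split !big_seq /=.
apply: eq_bigr => p /fillings_fromP[k' [p' [-> _]]] /=.
by rewrite mulrDl.
Qed.

Lemma sum_fillings xs ks : all (leq 1) ks ->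
  \sum_(p <- fillings ks) strict_sum xs p * t ^+ (size ks - size p)
  = interp_sum xs ks.
Proof.
case: ks => [_|k ks /= /andP[]]; last exact: sum_fillings_from.
by rewrite big_seq1 /= strict_sum0 interp_sum0 subnn mulr1.
Qed.

End InterpolatedSums.

(** * Generating functions of words *)

Lemma big_tuple_cons (A : nmodType) (L : finType) (j : nat) (G : seq L -> A) :
  \sum_(s : j.+1.-tuple L) G s = \sum_a \sum_(s : j.-tuple L) G (a :: s).
Proof.
rewrite pair_big /= (reindex (fun p : L * j.-tuple L => cons_tuple p.1 p.2)) //=.
exists (fun s => (thead s, behead_tuple s)) => [[a s]|s] _ /=.
  by congr pair; apply: val_inj.
by rewrite [s in RHS]tuple_eta; apply: val_inj.
Qed.

Section GeneratingFunction.
Variables (A : comNzRingType) (t : A) (X : Type) (f : nat -> X -> A).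
Variables (M : comAlgType A) (K : nat) (c : 'I_K -> M).

Definition word_sum (U : seq nat -> A) (j : nat) : M :=
  \sum_(s : j.-tuple 'I_K) U (map val s) *: \prod_(a <- s) c a.

Definition letter_sum (x : X) : M := \sum_(a < K) f a x *: c a.

(* The geometric series [1 + F v / (1 - t F v)], with [F] the letter sum and [v] the
   variable ['X], truncated after [v ^ L]. *)
Definition local_gen (L : nat) (x : X) : {poly M} :=
  1 + \sum_(i < L) (t%:A ^+ i * letter_sum x ^+ i.+1)%:P * 'X^(i.+1).

Lemma word_sum0 U : word_sum U 0 = (U [::])%:A.
Proof.
rewrite /word_sum (bigD1 [tuple]) //= big_nil big1 ?addr0 // => s /eqP[].
exact: tuple0.
Qed.

Lemma word_sumD U V j : word_sum (fun s => U s + V s) j = word_sum U j + word_sum V j.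
Proof. by rewrite /word_sum -big_split; apply: eq_bigr => s _; rewrite scalerDl. Qed.

Lemma word_sum_ext U V j :
  (forall s, size s = j -> U s = V s) -> word_sum U j = word_sum V j.
Proof. by move=> h; apply: eq_bigr => s _; rewrite h // size_map size_tuple. Qed.

Lemma word_sum_head x U j :
  word_sum (fun s => f (head 0%N s) x * U (behead s)) j.+1 = letter_sum x * word_sum U j.
Proof.
rewrite /word_sum (big_tuple_cons _ (fun s : seq 'I_K =>
  (f (head 0%N (map val s)) x * U (behead (map val s))) *: \prod_(a <- s) c a)).
rewrite /letter_sum mulr_suml; apply: eq_bigr => a _.
rewrite mulr_sumr; apply: eq_bigr => s _ /=.
by rewrite big_cons -scalerAl -scalerAr scalerA.
Qed.

(** The index [i] counts the entries that join [x], each contributing [t] times the letter sum; the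
    other [j - i] are summed over [xs]. *)
Lemma word_sum_tied x xs j :
  word_sum (tied_sum t f (interp_sum t f xs) x) j =
  \sum_(i < j.+1) (t%:A * letter_sum x) ^+ i * word_sum (interp_sum t f xs) (j - i).
Proof.
elim: j => [|j IH].
  by rewrite big_ord1 expr0 mul1r !word_sum0 interp_sum0.
rewrite big_ord_recl expr0 mul1r subn0.
under eq_bigr => i _ do rewrite /= subSS exprS -mulrA.
rewrite -mulr_sumr -IH -mulrA -word_sum_head -scalerAl mul1r.
rewrite /word_sum scaler_sumr -big_split; apply: eq_bigr => s _ /=.
rewrite scalerA -scalerDl; case: s => [[|a s] //= _].
by rewrite mulrA.
Qed.

(** In the last sum [i.+1] entries sit at [x], and the first of them carries no [t]. *)
Lemma word_sum_interp_cons x xs j :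
  word_sum (interp_sum t f (x :: xs)) j =
  word_sum (interp_sum t f xs) j + \sum_(i < j)
    t%:A ^+ i * letter_sum x ^+ i.+1 * word_sum (interp_sum t f xs) (j - i.+1).
Proof.
case: j => [|j].
  by rewrite big_ord0 addr0 !word_sum0 !interp_sum0.
under [X in _ + X]eq_bigr => i _ do
  rewrite subSS exprS mulrCA -exprMn -mulrA.
rewrite -mulr_sumr -word_sum_tied -word_sum_head -word_sumD; apply: word_sum_ext.
by case.
Qed.

(** Truncating each factor after degree [L] does not affect the coefficients up to [L];
    multiplication by one factor is the recursion of [word_sum_interp_cons]. *)
Lemma coef_prod_local_gen L xs j : (j <= L)%N ->
  (\prod_(x <- xs) local_gen L x)`_j = word_sum (interp_sum t f xs) j.
Proof.
elim: xs j => [|x xs IH] j le_jL.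
  rewrite big_nil coef1; case: j {le_jL} => [|j].
    by rewrite word_sum0 /= scale1r.
  rewrite /word_sum big1 //; case=> [[|a s] //= _] _; exact: scale0r.
rewrite big_cons /local_gen mulrDl mul1r coefD IH // word_sum_interp_cons.
congr (_ + _); rewrite mulr_suml coef_sum.
under [LHS]eq_bigr => i _ do rewrite -mulrA coefCM coefXnM.
rewrite (big_ord_widen _ (fun i => t%:A ^+ i * letter_sum x ^+ i.+1
  * word_sum (interp_sum t f xs) (j - i.+1)) le_jL) [RHS]big_mkcond.
apply: eq_bigr => i _; rewrite ltnS; case: ltnP => // lt_ij; last by rewrite mulr0.
by rewrite IH // (leq_trans (leq_subr _ _)).
Qed.
End GeneratingFunction.

(** * Strictly decreasing sums *)

Section StrictSum.
Variables (A : comNzRingType) (f : nat -> nat -> A) (n : nat).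

(** The bound [B] is kept apart from the type ['I_n] so that it can vary in an induction. *)
Definition decr_sum (B : nat) (ks : seq nat) : A :=
  \sum_(s : (size ks).-tuple 'I_n | path gtn B (map val s) && all (leq 1) (map val s))
    \prod_(p <- zip ks (map val s)) f p.1 p.2.

Lemma decr_sum_nil B : decr_sum B [::] = 1.
Proof.
rewrite /decr_sum (bigD1 [tuple]) //= big_nil big1 ?addr0 // => s /andP[_ /eqP[]].
exact: tuple0.
Qed.

Lemma decr_sum_cons B k ks :
  decr_sum B (k :: ks) =
  \sum_(a < n | (0 < a < B)%N) f k a * decr_sum a ks.
Proof.
rewrite /decr_sum big_mkcond /=.
rewrite (big_tuple_cons _ (fun s : seq 'I_n =>
  if path gtn B (map val s) && all (leq 1) (map val s)
  then \prod_(p <- zip (k :: ks) (map val s)) f p.1 p.2 else 0)).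
rewrite [RHS]big_mkcond; apply: eq_bigr => a _.
rewrite mulr_sumr [in RHS]big_mkcond /=.
case: ifP => [/andP[a_gt0 a_lt]|a_out].
  apply: eq_bigr => s _; rewrite a_gt0 a_lt /=.
  by case: ifP => _ //; rewrite big_cons.
rewrite big1 // => s _; case: ifP => // /andP[/andP[a_lt _] /andP[a_gt0 _]].
by rewrite a_gt0 a_lt in a_out.
Qed.

(** The first index is either below [B.+1] or equal to it, as in the recursion of [strict_sum]. *)
Lemma decr_sumS B k ks : (B.+1 < n)%N ->
  decr_sum B.+2 (k :: ks) = decr_sum B.+1 (k :: ks) + f k B.+1 * decr_sum B.+1 ks.
Proof.
move=> ltBn; rewrite !decr_sum_cons (bigD1 (Ordinal ltBn)) ?ltnSn //= addrC.
congr (_ + _); apply: eq_bigl => a.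
by rewrite -val_eqE /=; lia.
Qed.

Lemma decr_sumE B ks : (B < n)%N ->
  decr_sum B.+1 ks = strict_sum f (rev (iota 1 B)) ks.
Proof.
elim: B ks => [|B IH] [|k ks] ltBn; rewrite ?decr_sum_nil ?strict_sum0 //.
  rewrite decr_sum_cons big_pred0 // => a; lia.
have -> : rev (iota 1 B.+1) = B.+1 :: rev (iota 1 B).
  by rewrite -[X in iota _ X]addn1 iotaD rev_cat add1n.
by rewrite decr_sumS // !IH // ltnW.
Qed.

End StrictSum.

Lemma zbar_strict_sum (F : fieldType) (n : nat) (q : F) (ks : seq nat) : (0 < n)%N ->
  zbar n q ks = strict_sum (fun k m => q ^+ (k.-1 * m)%N / (1 - q ^+ m) ^+ k)
                  (rev (iota 1 n.-1)) ks.
Proof.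
case: n => // n _; rewrite -(@decr_sumE _ _ n.+1) //.
rewrite /zbar /decr_sum.
rewrite (reindex (fun s : (size ks).-tuple 'I_n.+1 => [ffun i => tnth s i])) /=; last first.
  exists (fun m => [tuple m i | i < size ks]) => [s|m] _.
    by apply: eq_from_tnth => i; rewrite tnth_mktuple ffunE.
  by apply/ffunP => i; rewrite ffunE tnth_mktuple.
apply: eq_big => [s|s _].
  (* The path condition splits into a bound, automatic in ['I_n.+1], and sortedness, which by
     transitivity gives the pairwise inequalities. *)
  rewrite andbC path_sortedE; last by move=> x y z /= h1 h2; apply: ltn_trans h2 h1.
  have -> : all (gtn n.+1) (map val s).
    by apply/allP => x /mapP[y _ ->] /=.
  have nthE (i : 'I_(size ks)) : nth 0%N (map val s) i = tnth s i.
    by rewrite (nth_map ord0) ?size_tuple // (tnth_nth ord0).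
  have szs : size (map val s) = size ks by rewrite size_map size_tuple.
  rewrite sorted_pairwise; last by move=> x y z /= h1 h2; apply: ltn_trans h2 h1.
  congr andb.
    apply/forallP/(pairwiseP 0%N) => [h i j|h i].
      rewrite !inE szs => lti ltj ltij.
      have /forallP/(_ (Ordinal ltj))/implyP/(_ ltij) := h (Ordinal lti).
      by rewrite !ffunE -!nthE.
    apply/forallP => j; apply/implyP => ltij; rewrite !ffunE -!nthE.
    by apply: h; rewrite ?inE ?szs.
  apply/forallP/(all_nthP 0%N) => [h i|h i].
    by rewrite szs => lti; move: (h (Ordinal lti)); rewrite ffunE -nthE.
  by rewrite ffunE -nthE; apply: h; rewrite szs.
rewrite (big_nth (0%N, 0%N)) size_zip size_map size_tuple minnn big_mkord.
apply: eq_bigr => i _; rewrite ffunE nth_zip ?size_map ?size_tuple //=.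
by rewrite (nth_map ord0) ?size_tuple // (tnth_nth ord0).
Qed.

(** * Symmetric functions and rationality *)

Section SymmetricImage.
Variables (B C : comNzRingType) (phi : {rmorphism B -> C}).

Lemma image_sum (I : Type) (s : seq I) (P : pred I) (F : I -> C) :
  (forall i, P i -> exists b, phi b = F i) ->
  exists b, phi b = \sum_(i <- s | P i) F i.
Proof.
move=> h; elim/big_ind: _ => [|x y [a <-] [b <-]|//].
  by exists 0; rewrite rmorph0.
by exists (a + b); rewrite rmorphD.
Qed.

Lemma image_prod (I : Type) (s : seq I) (P : pred I) (F : I -> C) :
  (forall i, P i -> exists b, phi b = F i) ->
  exists b, phi b = \prod_(i <- s | P i) F i.
Proof.
move=> h; elim/big_ind: _ => [|x y [a <-] [b <-]|//].
  by exists 1; rewrite rmorph1.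
by exists (a * b); rewrite rmorphM.
Qed.

(** By the fundamental theorem, [P] is a polynomial over [B] in the elementary symmetric ones, whose
    values lie in the image of [phi]. *)
Lemma symmetric_image (N : nat) (v : 'I_N -> C) (P : {mpoly B[N]}) :
  (forall k : 'I_N, exists b, phi b = mmap phi v (mesym N B k.+1)) ->
  P \is symmetric -> exists b, phi b = mmap phi v P.
Proof.
move=> hv /sym_fundamental[T [<- _]].
rewrite comp_mpolyEX rmorph_sum; apply: image_sum => m _.
rewrite /= mmapZ comp_mpolyX rmorph_prod /=.
have [b <-] : exists b, phi b = \prod_(i < N)
    mmap phi v (tnth [tuple mesym N B i.+1 | i < N] i ^+ m i).
  apply: image_prod => i _; rewrite rmorphXn /= tnth_mktuple.
  by have [b <-] := hv i; exists (b ^+ m i); rewrite rmorphXn.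
by exists (T@_m * b); rewrite rmorphM.
Qed.

Lemma mmap_mesym (K : comNzRingType) (emb : {rmorphism K -> C})
    (N k : nat) (v : 'I_N -> K) :
  mmap phi (emb \o v) (mesym N B k) = emb (meval v (mesym N K k)).
Proof.
rewrite /mesym rmorph_sum [meval _ _]rmorph_sum rmorph_sum; apply: eq_bigr => h _ /=.
rewrite rmorph_prod [meval _ _]rmorph_prod rmorph_prod; apply: eq_bigr => i _ /=.
by rewrite mmapX mmap1U mevalXU.
Qed.

End SymmetricImage.

(* [local_gen] over an arbitrary ring, as a function of [y = 1 / (1 - q ^ m)], so that
   it can be moved along ring morphisms. *)
Definition gen_factor (B : comNzRingType) (t v : B) (K : nat) (c : 'I_K -> B)
    (L : nat) (y : B) : B :=
  1 + \sum_(i < L) t ^+ i * (\sum_(a < K) y * (y - 1) ^+ a.-1 * c a) ^+ i.+1 * v ^+ i.+1.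

Lemma rmorph_gen_factor (B C : comNzRingType) (phi : {rmorphism B -> C})
    t v K (c : 'I_K -> B) L y :
  phi (gen_factor t v c L y) = gen_factor (phi t) (phi v) (phi \o c) L (phi y).
Proof.
rewrite /gen_factor rmorphD rmorph1 rmorph_sum; congr (_ + _).
apply: eq_bigr => i _; rewrite !rmorphM !rmorphXn; congr (_ * _ ^+ _ * _).
rewrite rmorph_sum; apply: eq_bigr => a _.
by rewrite !rmorphM rmorphXn rmorphB rmorph1.
Qed.

Lemma gen_factor_ext (B : comNzRingType) (t v : B) K (c c' : 'I_K -> B) L y :
  c =1 c' -> gen_factor t v c L y = gen_factor t v c' L y.
Proof.
move=> h; rewrite /gen_factor; congr (_ + _); apply: eq_bigr => i _.
by congr (_ * _ ^+ _ * _); apply: eq_bigr => a _; rewrite h.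
Qed.

(** With formal variables in place of the [y i], the product is symmetric over [B]: permuting the
    variables permutes its factors. *)
Lemma prod_gen_factor_image (B C : comNzRingType) (phi : {rmorphism B -> C})
  t v K (c : 'I_K -> B) L N (y : 'I_N -> C) :
  (forall k : 'I_N, exists b, phi b = mmap phi y (mesym N B k.+1)) ->
  exists b, phi b = \prod_(i < N) gen_factor (phi t) (phi v) (phi \o c) L (y i).
Proof.
move=> hy.
pose P : {mpoly B[N]} := \prod_(i < N)
   gen_factor t%:MP v%:MP (fun a => (c a)%:MP) L 'X_i.
have [|b bE] := @symmetric_image _ _ phi _ y P hy.
  apply/issymP => s; rewrite /P rmorph_prod /=.
  rewrite [RHS](reindex_inj (@perm_inj _ s)) /=.
  apply: eq_bigr => i _; rewrite (rmorph_gen_factor (msym s)).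
  have symC x : msym s x%:MP = x%:MP :> {mpoly B[N]} by exact: mmapC.
  rewrite /=; have -> : msym s 'X_i = 'X_(s i) :> {mpoly B[N]} by rewrite /msym mmapX mmap1U.
  rewrite !symC; apply: gen_factor_ext => a; exact: symC.
exists b; rewrite bE rmorph_prod /=; apply: eq_bigr => i _.
rewrite (rmorph_gen_factor (mmap phi y)) /= !mmapC mmapX mmap1U.
by apply: gen_factor_ext => a /=; rewrite mmapC.
Qed.

(** For [b = 1 / (1 - z ^+ i)] one has [b - 1 = z ^+ i * b], so [b ^+ n = (b - 1) ^+ n]. These
    [n.-1] distinct values are all the roots of a rational polynomial of degree [n.-1], and Vieta's
    formulas apply. *)
Lemma mesym_inv_rat (K : numFieldType) (n : nat) (z : K) (k : nat) :
  n.-primitive_root z -> (k <= n.-1)%N ->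
  exists q : rat, ratr q =
    meval (fun i : 'I_n.-1 => (1 - z ^+ i.+1)^-1) (mesym n.-1 K k).
Proof.
move=> zP le_k; have n_gt0 := prim_order_gt0 zP.
pose b (i : 'I_n.-1) := (1 - z ^+ i.+1)^-1.
pose cs := [tuple b i | i < n.-1].
have nz (i : 'I_n.-1) : 1 - z ^+ i.+1 != 0.
  rewrite subr_eq0 eq_sym -(expr0 z) (eq_prim_root_expr zP) mod0n modn_small //.
  by have := ltn_ord i; lia.
have b_inj : injective b.
  move=> i j /invr_inj/addrI/oppr_inj/eqP; rewrite (eq_prim_root_expr zP).
  have [li lj] := (ltn_ord i, ltn_ord j).
  by rewrite !modn_small; [move=> /eqP[] /val_inj|lia|lia].
pose Dq : {poly rat} := 'X^n - ('X - 1) ^+ n.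
pose D : {poly K} := map_poly ratr Dq.
have DE : D = 'X^n - ('X - 1) ^+ n.
  by rewrite /D rmorphB !rmorphXn rmorphB /= map_polyX rmorph1.
have Droot : all (root D) cs.
  apply/allP => x /mapP[i _ ->]; rewrite /root DE !hornerE.
  have -> : b i - 1 = z ^+ i.+1 * b i.
    by rewrite /b; have := nz i => h; field.
  by rewrite exprMn exprAC (prim_expr_order zP) expr1n mul1r subrr.
have cs_uniq : uniq cs by rewrite map_inj_uniq ?enum_uniq.
have D_neq0 : D != 0.
  apply: contraTneq isT => D0; have := congr1 (horner^~ 0) D0.
  rewrite DE !hornerE expr0n -(negbK (n == 0%N)) -lt0n n_gt0 /=.
  by move/eqP; rewrite sub0r oppr_eq0 signr_eq0.
(* The leading terms of ['X^n] and [('X - 1) ^+ n] cancel. *)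
have szD : (size D <= n)%N.
  apply/leq_sizeP => j; rewrite leq_eqVlt => /orP[/eqP <-|lt_nj].
    rewrite DE coefB coefXn eqxx -[X in 'X - X]/(1%:P).
    have := monicP (monic_exp n (monicXsubC (1 : K))).
    by rewrite /lead_coef size_exp_XsubC => ->; rewrite subrr.
  rewrite DE coefB coefXn gtn_eqF // sub0r -[X in 'X - X]/(1%:P).
  by rewrite nth_default ?oppr0 // size_exp_XsubC.
have szDE : size D = (size cs).+1.
  have := max_poly_roots D_neq0 Droot cs_uniq; rewrite size_tuple => h.
  by apply/eqP; rewrite eqn_leq h andbT; lia.
have := all_roots_prod_XsubC szDE Droot; rewrite uniq_rootsE => /(_ cs_uniq) Dfac.
have lcD : lead_coef D = ratr (lead_coef Dq) by rewrite lead_coef_map.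
have := @mroots_coeff _ _ cs (Ordinal (le_k : k < n.-1.+1)%N) => /=.
have -> : \prod_(c <- cs) ('X - c%:P) = map_poly ratr ((lead_coef Dq)^-1 *: Dq).
  rewrite map_polyZ fmorphV /= -lcD -/D [X in _ *: X]Dfac scalerA mulVf ?scale1r //.
  by rewrite lead_coef_eq0.
rewrite coef_map /= => kE.
(* The sign cancels the one in Vieta's formula. *)
exists ((-1) ^+ k * ((lead_coef Dq)^-1 *: Dq)`_(n.-1 - k)).
rewrite rmorphM rmorphXn rmorphN rmorph1 /= kE signrMK.
by apply: meval_eq => i; rewrite tnth_mktuple.
Qed.

(** * The summand in terms of [1 / (1 - q ^+ m)] *)

Section RootOfUnity.
Variables (F : fieldType) (q : F).

Definition harmonic_term (k m : nat) : F := q ^+ (k.-1 * m)%N / (1 - q ^+ m) ^+ k.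

Lemma harmonic_termE k m : (0 < k)%N ->
  harmonic_term k m = (1 - q ^+ m)^-1 * ((1 - q ^+ m)^-1 - 1) ^+ k.-1.
Proof.
case: k => // k _ /=; rewrite /harmonic_term mulnC exprM.
(* If [q ^+ m = 1], both sides are 0 because the inverse of 0 is 0. *)
have [->|nz] := eqVneq (1 - q ^+ m) 0; first by rewrite invr0 mul0r expr0n invr0 mulr0.
have -> : (1 - q ^+ m)^-1 - 1 = q ^+ m * (1 - q ^+ m)^-1 by field.
by rewrite exprMn exprVn exprS invfM mulrCA.
Qed.

(** With [b] the inverse of [1 - q ^+ m], the left side is [b * (b - 1) ^+ (k + k1 - 2)] times
    [(b - 1) + 1 = b]. *)
Lemma harmonic_term_merge k k1 m : (0 < k)%N -> (0 < k1)%N ->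
  harmonic_term (k + k1) m + harmonic_term (k.-1 + k1) m =
  harmonic_term k m * harmonic_term k1 m.
Proof.
case: k k1 => // k [//|k1] _ _; rewrite !harmonic_termE ?addnS //= addSn exprD exprS exprD.
by ring.
Qed.

Lemma strict_sum_polyC xs ks :
  (strict_sum harmonic_term xs ks)%:P =
  strict_sum (fun k m => (harmonic_term k m)%:P) xs ks.
Proof.
elim: xs ks => [|x xs IH] [|k ks] //=.
by rewrite polyCD polyCM !IH.
Qed.

Lemma zbart_interp_sum n ks : (0 < n)%N -> all (leq 1) ks ->
  zbart n q ks =
  interp_sum 'X (fun k m => (harmonic_term k m)%:P) (rev (iota 1 n.-1)) ks.
Proof.
move=> n_gt0 ks_gt0; rewrite -sum_fillings //; last first.
  by move=> k k1 m k_gt0 k1_gt0; rewrite -polyCD -polyCM harmonic_term_merge.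
apply: eq_bigr => p _; by rewrite zbar_strict_sum // -strict_sum_polyC.
Qed.

End RootOfUnity.

(** * Weight and heights as monomials *)

Section Content.
Variables (k r : nat).

(* The variable of index 0 records the weight, the one of index i records the
   i-height. *)
Definition letter_content (a : nat) : 'X_{1..r.+1} :=
  [multinom if unlift ord0 i is Some j then (j.+1 < a : nat) else a | i < r.+1].

(* Entries of a multi-index are positive, so the entry 0 gets weight 0. *)
Definition letter (A : comNzRingType) (a : 'I_k.+1) : {mpoly A[r.+1]} :=
  if a == 0 :> nat then 0 else 'X_[letter_content a].

Definition content (h : 'I_r -> nat) : 'X_{1..r.+1} :=
  [multinom if unlift ord0 i is Some j then h j else k | i < r.+1].

Lemma prod_letter (A : comNzRingType) (s : seq 'I_k.+1) :
  \prod_(a <- s) letter A a =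
  if all (leq 1) (map val s) then 'X_[\sum_(a <- s) letter_content a] else 0.
Proof.
elim: s => [|a s IH]; first by rewrite !big_nil mpolyX0.
rewrite !big_cons IH /= /letter; case: posnP => [->|a_gt0] /=; first by rewrite mul0r.
by case: ifP => _; rewrite ?mulr0 // mpolyXD.
Qed.

Lemma sum_letter_content (s : seq 'I_k.+1) (h : 'I_r -> nat) :
  (\sum_(a <- s) letter_content a == content h)%MM =
  (weight (map val s) == k) && [forall j : 'I_r, height j.+1 (map val s) == h j].
Proof.
have E (i : 'I_r.+1) : (\sum_(a <- s) letter_content a)%MM i =
   if unlift ord0 i is Some j then height j.+1 (map val s) else weight (map val s).
  rewrite mnm_sumE; under eq_bigr => a _ do rewrite mnmE.
  case: unliftP => [j _|_].
    by rewrite /height -sum1_count big_map [RHS]big_mkcond; apply: eq_bigr => a _; case: ifP.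
  by rewrite /weight sumnE big_map.
apply/eqP/andP => [/mnmP h_eq|[/eqP wE /forallP hE]].
  split; first by have := h_eq ord0; rewrite E mnmE unlift_none => ->.
  by apply/forallP => j; have := h_eq (lift ord0 j); rewrite E mnmE liftK => ->.
apply/mnmP => i; rewrite E mnmE; case: unliftP => [j _|_]; last exact: wE.
exact/eqP.
Qed.

(** The monomial [content h] selects the words of weight [k] and heights [h]; those with an entry 0
    contribute 0. *)
Lemma mcoeff_word_sum (A : comNzRingType) (U : seq nat -> A) l (h : 'I_r -> nat) :
  (word_sum (letter A) U l)@_(content h) = \sum_(ks in index_set k l h) U (map val ks).
Proof.
rewrite /word_sum raddf_sum [RHS]big_mkcond; apply: eq_bigr => s _ /=.
rewrite mcoeffZ prod_letter inE /=.
have -> : depth (map val s) == l by rewrite /depth size_map size_tuple.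
rewrite [all (fun x => _) _](_ : _ = all (leq 1) (map val s)) //.
case: (all (leq 1) _) => /=; last by rewrite mcoeff0 mulr0.
rewrite mcoeffX sum_letter_content.
by case: (_ && _); rewrite (mulr1, mulr0).
Qed.

End Content.

(** * Rationality of the sums *)

Lemma local_gen_factor (A : comNzRingType) (t b : A) (X : Type) (f : nat -> X -> A)
    (M : comAlgType A) (K : nat) (c : 'I_K -> M) (L : nat) (x : X) :
  (forall a : 'I_K, c a = 0 \/ f a x = b * (b - 1) ^+ a.-1) ->
  local_gen t f c L x = gen_factor (t%:A)%:P 'X (polyC \o c) L (b%:A)%:P.
Proof.
move=> hc; rewrite /local_gen /gen_factor; congr (_ + _).
apply: eq_bigr => j _; rewrite polyCM !rmorphXn /=; congr (_ * _ ^+ _ * _).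
rewrite /letter_sum rmorph_sum; apply: eq_bigr => a _ /=.
case: (hc a) => ->; first by rewrite scaler0 !rmorph0 mulr0.
have -> : (b * (b - 1) ^+ a.-1) *: c a = (b * (b - 1) ^+ a.-1)%:A * c a.
  by rewrite -scalerAl mul1r.
by rewrite -[_%:A]/(in_alg M _) !rmorphM !rmorphXn !rmorphB !rmorph1.
Qed.

Lemma Gsum_rat (K : numFieldType) (n r : nat) (z : K) (k l : nat) (h : 'I_r -> nat) :
  n.-primitive_root z ->
  exists p : {poly rat}, Gsum n z k l h = map_poly ratr p.
Proof.
move=> zP; have n_gt0 := prim_order_gt0 zP; rewrite /Gsum.
case: ifP => _; first by exists 1; rewrite rmorph1.
pose f a m := (harmonic_term z a m)%:P.
pose xs := rev (iota 1 n.-1).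
have -> : \sum_(ks in index_set k l h) zbart n z (map val ks) =
    \sum_(ks in index_set k l h) interp_sum 'X f xs (map val ks).
  apply: eq_bigr => ks; rewrite inE => /and4P[ks_gt0 _ _ _].
  exact: zbart_interp_sum.
rewrite -mcoeff_word_sum -(@coef_prod_local_gen _ _ _ _ _ _ _ l) //.
(* The rationals are embedded through three layers of polynomials: [t] innermost, then weight and
   heights, and depth outermost. *)
pose phi0 : {rmorphism {mpoly {poly rat}[r.+1]} -> {mpoly {poly K}[r.+1]}} :=
  map_mpoly (map_poly ratr).
pose phi : {rmorphism {poly {mpoly {poly rat}[r.+1]}} -> {poly {mpoly {poly K}[r.+1]}}} :=
  map_poly phi0.
have phiX : phi 'X = 'X by exact: map_polyX.
have phiC c : phi c%:P = (phi0 c)%:P by exact: map_polyC.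
have phi0C p : phi0 p%:MP = (map_poly ratr p)%:MP by exact: map_mpolyC.
have phi0X m : phi0 'X_[m] = 'X_[m] by exact: map_mpolyX.
have phi0A p : phi0 p%:A = (map_poly ratr p)%:A.
  by rewrite -!mul_mpolyC !mulr1 phi0C.
pose emb : {rmorphism K -> {poly {mpoly {poly K}[r.+1]}}} :=
  polyC \o (in_alg {mpoly {poly K}[r.+1]} \o polyC).
pose b (i : 'I_n.-1) := (1 - z ^+ i.+1)^-1.
pose c : 'I_k.+1 -> {poly {mpoly {poly rat}[r.+1]}} := polyC \o @letter k r {poly rat}.
have [w wE] : exists w, phi w = \prod_(i < n.-1)
    gen_factor (phi ('X%:A)%:P) (phi 'X) (phi \o c) l (emb (b i)).
  apply: prod_gen_factor_image => i; rewrite mmap_mesym.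
  have [|u <-] := @mesym_inv_rat _ _ _ i.+1 zP; first exact: ltn_ord.
  by exists (u%:P%:A)%:P; rewrite phiC phi0A map_polyC.
(* Since [phi] acts on coefficients, the witness is the coefficient of [w] at depth [l] and content
   [h]. *)
exists (w`_l)@_(content k h).
suff -> : \prod_(x <- xs) local_gen 'X f (@letter k r {poly K}) l x = phi w.
  by rewrite coef_map mcoeff_map_mpoly.
rewrite wE (perm_big _ (permEl (perm_rev _))) /=.
have -> : iota 1 n.-1 = index_iota 1 n.-1.+1 by rewrite /index_iota subSS subn0.
rewrite big_add1 big_mkord; apply: eq_bigr => i _.
rewrite (@local_gen_factor _ _ (b i)%:P); last first.
  (* The entry 0, where the closed form of [f] can fail, has letter 0. *)
  move=> a; rewrite /letter; case: posnP => [_|a_gt0]; [by left|right].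
  by rewrite /f harmonic_termE // polyCM rmorphXn rmorphB.
rewrite phiX phiC phi0A map_polyX; apply: gen_factor_ext => a.
rewrite /= phiC /letter; case: posnP => _; first by rewrite (rmorph0 phi0).
by rewrite phi0X.
Qed.

Theorem corollary1p2 (R : realType) (n r : nat) (hn : (0 < n)%N) (hr : (0 < r)%N)
  (zeta : R[i]) (hzeta : n.-primitive_root zeta)
  (k l : nat) (h : 'I_r -> nat) :
  exists p : {poly rat}, Gsum n zeta k l h = map_poly ratr p.
Proof. exact: Gsum_rat hzeta. Qed.
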